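(* Let $n\ge 2$, let $(C,\mathcal{F})$ be a cake (a nonempty set with an algebra of subsets), let $\mathcal{V}$ be a nonempty class of value measures on $(C,\mathcal{F})$, and let $P$ be an $n$-player cake-cutting (allocation) procedure for $(C,\mathcal{F},\mathcal{V})$. If $P$ is fair, then $P$ is strategy-proof.
   Context: **Value measures.** A value measure on $(C,\mathcal{F})$ is a function $v:\mathcal{F}\to[0,1]$ that is nonnegative and additive, with $v(\emptyset)=0$ and $v(C)=1$. $\mathcal{V}$ is the class of value measures that players may have and may declare. **Allocation.** An allocation is an ordered partition $(S_1,\dots,S_n)$ of $C$ into $n$ pairwise disjoint (possibly empty) members of $\mathcal{F}$ with union $C$; player $i$ receives $S_i$. **Procedure.** Each player $i$ has a true value measure $v_i\in\mathcal{V}$ and sends to a referee a declared value measure $d_i\in\mathcal{V}$, which may differ from $v_i$ (in which case the player misrepresents his value). A procedure $P$ associates to each profile of declarations $(d_1,\dots,d_n)\in\mathcal{V}^n$ a nonempty set $P(d_1,\dots,d_n)$ of allocations, the possible outcomes. (A deterministic procedure has exactly one possible outcome for each profile; more than one possible outcome allows for, e.g., random breaking of ties.) **Fair.** $P$ is fair if each player can guarantee receiving a portion he values at least $1/n$. That is: for every player $i$ and every true value measure $v\in\mathcal{V}$ there is a declaration $d_i\in\mathcal{V}$ such that, for all declarations $d_j\in\mathcal{V}$ ($j\neq i$) of the other players and every possible outcome $(S_1,\dots,S_n)\in P(d_1,\dots,d_n)$, one has $v(S_i)\ge 1/n$. **Strategy-vulnerable and strategy-proof.** $P$ is strategy-vulnerable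 if some player can, by misrepresenting his value measure, assuredly do better than the fair share $1/n$, whatever the other players' value measures are and whatever they declare. That is: there exist a player $i$, a true value measure $v\in\mathcal{V}$ and a declaration $u\in\mathcal{V}$ with $u\ne v$ such that, whenever $d_i=u$, for all declarations $d_j\in\mathcal{V}$ ($j\ne i$) and every possible outcome $(S_1,\dots,S_n)\in P(d_1,\dots,d_n)$, one has $v(S_i)>1/n$. Otherwise $P$ is strategy-proof. *)

(* Defs.v *)
From mathcomp Require Import all_boot all_order all_algebra.
From mathcomp Require Import all_classical all_reals measure.

Set Implicit Arguments.
Unset Strict Implicit.
Unset Printing Implicit Defensive.
Import Order.TTheory GRing.Theory Num.Theory.

Local Open Scope classical_set_scope.
Local Open Scope ring_scope.

(* A cake (C, F) is [C : algebraOfSetsType disp]: the carrier is nonempty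
   because the structure extends [pointedType], and F is [measurable], which is
   an algebra of sets, not necessarily a sigma-algebra. *)

Section Events.
Context {disp : measure_display} (C : algebraOfSetsType disp).

(* The members of F. Value measures have this type as their domain, rather than
   the whole of [set C], so that their equality is equality as functions on F. *)
Definition event : Type := set_type (@measurable disp C).

Definition event0 : event := exist _ set0 (mem_set measurable0).

Definition eventT : event := exist _ setT (mem_set measurableT).

Definition eventU (A B : event) : event :=
  exist _ (val A `|` val B)
    (mem_set (measurableU _ _ (set_mem (valP A)) (set_mem (valP B)))).

End Events.

Definition value_measure {disp : measure_display} {C : algebraOfSetsType disp}
    {R : realType} (v : event C -> R) : Prop :=
  [/\ forall A, 0 <= v A <= 1,
      forall A B, val A `&` val B = set0 -> v (eventU A B) = v A + v B,
      v (event0 C) = 0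
    & v (eventT C) = 1].

Definition allocation {disp : measure_display} {C : algebraOfSetsType disp}
    {n : nat} (S : 'I_n -> event C) : Prop :=
  trivIset setT (fun i => val (S i)) /\ \bigcup_i val (S i) = setT.

Section Procedures.
Context {disp : measure_display} {C : algebraOfSetsType disp} {R : realType}.
Context {V : set (event C -> R)} {n : nat}.

(* [P d] is the set of possible outcomes for the profile [d]; via the coercion
   [set_type], ['I_n -> V] is the type of profiles in V^n. *)
Implicit Type P : ('I_n -> V) -> set ('I_n -> event C).

Definition procedure P : Prop :=
  forall d, P d !=set0 /\ P d `<=` allocation.

Definition fair P : Prop :=
  forall (i : 'I_n) (v : V), exists u : V,
    forall d : 'I_n -> V, d i = u ->
    forall S, P d S -> n%:R^-1 <= val v (S i).

Definition strategy_vulnerable P : Prop :=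
  exists (i : 'I_n) (v u : V), u <> v /\
    forall d : 'I_n -> V, d i = u ->
    forall S, P d S -> n%:R^-1 < val v (S i).

Definition strategy_proof P : Prop := ~ strategy_vulnerable P.

End Procedures.

(* Main.v *)
Require Import Defs.
From mathcomp Require Import all_boot all_order all_algebra.
From mathcomp Require Import all_classical all_reals measure.

(** If a misrepresentation [u] assured player [i], whose true measure is [v],
    strictly more than [1/n], consider the profile in which [i] declares [u]
    and every other player declares what fairness provides for a player whose
    true measure is the same [v].  In any outcome [S] of that profile, [v]
    gives more than [1/n] to [S i] and at least [1/n] to each other portion,
    so the portions have total [v]-value more than [1].  But they partition
    the cake, and [v] is additive, so their total is exactly [1]
    ([sum_allocation]).  An outcome exists because procedures have nonempty
    sets of outcomes. *)

Import Order.TTheory GRing.Theory Num.Theory.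

Local Open Scope classical_set_scope.
Local Open Scope ring_scope.

Lemma val_big_eventU (disp : measure_display) (C : algebraOfSetsType disp)
    (I : Type) (s : seq I) (S : I -> event C) :
  val (\big[@eventU disp C/event0 C]_(j <- s) S j) =
  \big[setU/set0]_(j <- s) val (S j).
Proof. by apply: (big_morph val). Qed.

(** The union is iterated inside [event C], since a value measure is defined
    only on the members of the algebra. *)
Lemma value_measure_bigU (disp : measure_display) (C : algebraOfSetsType disp)
    (R : realType) (v : event C -> R) (I : choiceType) (s : seq I)
    (S : I -> event C) :
  value_measure v -> uniq s -> trivIset setT (fun j => val (S j)) ->
  v (\big[@eventU disp C/event0 C]_(j <- s) S j) = \sum_(j <- s) v (S j).
Proof.
move=> [_ vD v0 _] + trivS; elim: s => [|i s IHs] /=; first by rewrite !big_nil.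
move=> /andP[i_notin_s uniq_s]; rewrite !big_cons vD ?IHs//.
rewrite val_big_eventU -bigcup_seq -subset0 => x [xi [j /= js xj]].
have eq_ij : i = j by apply: trivS => //; exists x.
by rewrite eq_ij js in i_notin_s.
Qed.

Lemma sum_allocation (disp : measure_display) (C : algebraOfSetsType disp)
    (R : realType) (v : event C -> R) (n : nat) (S : 'I_n -> event C) :
  value_measure v -> allocation S -> \sum_j v (S j) = 1.
Proof.
move=> vm [trivS coverS]; have [_ _ _ vT] := vm.
rewrite -value_measure_bigU ?index_enum_uniq// -[RHS]vT; congr v.
apply: val_inj; rewrite val_big_eventU -bigcup_seq /= -coverS.
by apply: eq_bigcupl; split=> j //= _; rewrite mem_index_enum.
Qed.

Theorem theoremA (disp : measure_display) (C : algebraOfSetsType disp)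
    (R : realType) (V : set (event C -> R))
    (V_value : forall v, V v -> value_measure v) (V_nonempty : V !=set0)
    (n : nat) (n_ge2 : (2 <= n)%N)
    (P : ('I_n -> V) -> set ('I_n -> event C))
    (P_procedure : procedure P) :
  fair P -> strategy_proof P.
Proof.
move=> fairP [i [v [u [_ u_beats]]]].
have [guard guardP] := choice (fun j => fairP j v).
pose d j := if j == i then u else guard j.
have [[S PS] /(_ S PS) allocS] := P_procedure d.
have vm : value_measure (val v) by apply: V_value; exact: set_mem (valP v).
have n_neq0 : n%:R != 0 :> R by rewrite pnatr_eq0 -lt0n (ltnW n_ge2).
suff: (1 : R) < \sum_j val v (S j) by rewrite sum_allocation// ltxx.
have -> : (1 : R) = \sum_(j < n) n%:R^-1.
  by rewrite sumr_const card_ord -[RHS]mulr_natr mulVf.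
rewrite (bigD1 i)//= [ltRHS](bigD1 i)//=; apply: ltr_leD.
  by apply: (u_beats d) => //; rewrite /d eqxx.
apply: ler_sum => j /negbTE neq_ji.
by apply: (guardP j d) => //; rewrite /d neq_ji.
Qed.
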